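(* Suppose that $$ \left| a(|x|_K)\right| \le C|x|_K^{-\alpha -\varepsilon},\quad \left| f(|x|_K)\right| \le C|x|_K^{-\varepsilon},\quad \varepsilon >0,\ C>0, $$ as $|x|_K>1$. Then $u=I^\alpha v$ is a strong solution of the Cauchy problem $$ D^\alpha u+a(|x|_K)u=f(|x|_K),\quad x\in K,\qquad u(0)=0 . $$
   Context: $K$ is a non-Archimedean local field with normalized absolute value $|\cdot|_K$ (taking values $q^N$, $N\in\mathbb Z$, where $q$ is the cardinality of the residue field), with Haar measure $dx$ normalized so that $\{|x|_K\le 1\}$ has measure 1. For $\alpha>0$, $D^\alpha$ is the fractional differentiation operator $(D^\alpha \varphi)(x)=\frac{1-q^\alpha}{1-q^{-\alpha-1}}\int_K |y|_K^{-\alpha-1}[\varphi(x-y)-\varphi(x)]\,dy$. For radial functions $u=u(|x|_K)$ satisfying $\sum_{k=-\infty}^m q^k|u(q^k)|<\infty$ and $\sum_{l=m}^\infty q^{-\alpha l}|u(q^l)|<\infty$ for some $m\in\mathbb Z$, this integral exists for $x\neq 0$ and depends only on $|x|_K$; $D^\alpha u$ is said to be defined in the strong sense if, in addition, the limit $\lim_{x\to 0}(D^\alpha u)(|x|_K)$ exists (taken as the value $(D^\alpha u)(0)$). The operator $I^\alpha$ (a right inverse of $D^\alpha$ vanishing at $0$) acts on radial functions by $(I^\alpha v)(0)=0$ and, for $x\neq 0$, $$(I^\alpha v)(|x|_K)=q^{-\alpha}|x|_K^\alpha v(|x|_K)+\frac{1-q^{-\alpha}}{1-q^{\alpha-1}}\int_{|y|_K<|x|_K}\left(|x|_K^{\alpha-1}-|y|_K^{\alpha-1}\right)v(|y|_K)\,dy,\quad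 \alpha\neq1,$$ $$(I^1 v)(|x|_K)=q^{-1}|x|_K v(|x|_K)+\frac{1-q}{q\log q}\int_{|y|_K<|x|_K}\left(\log|x|_K-\log|y|_K\right)v(|y|_K)\,dy .$$ Here $a$ and $f$ are continuous radial functions (having finite limits $a(0)$, $f(0)$ as $x\to 0$), and it is assumed that $a(|x|_K)\neq -q^{\alpha m}$ for all $x\in K$, $m\in\mathbb Z$. Under these assumptions the integral equation $v(|x|_K)+a(|x|_K)(I^\alpha v)(|x|_K)=f(|x|_K)$, $x\in K$, has a unique continuous radial solution $v$ on all of $K$ (obtained on a ball $\{|x|_K\le q^N\}$ by the Fredholm alternative for the compact Volterra-type integral operator, and extended successively to larger spheres using the equation itself); $v$ denotes this solution. A strong solution of the Cauchy problem means a continuous radial $u$ for which $D^\alpha u$ is defined in the strong sense and the equation holds pointwise. *)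

(* Defs.v *)
From HB Require Import structures.
From mathcomp Require Import all_boot all_order all_algebra.
From mathcomp Require Import all_classical all_reals all_analysis.
Set Implicit Arguments. Unset Strict Implicit. Unset Printing Implicit Defensive.
Import Order.TTheory GRing.Theory Num.Theory.
Import numFieldNormedType.Exports.
Local Open Scope classical_set_scope.
Local Open Scope ring_scope.

Section LocalFieldCarrier.
Variable K : fieldType.

(* K, pointed by 0 (needed to build the generated sigma-algebra) *)
Definition pointedK : Type := K.
HB.instance Definition _ := Choice.on pointedK.
HB.instance Definition _ := isPointed.Build pointedK (0 : K).

Variable R : realType.
Variable absK : K -> R.

Definition ballsK : set (set pointedK) :=
  [set B | exists (c : K) (r : R), B = [set y : pointedK | absK ((y : K) - c) <= r]].

Definition KBorel := g_sigma_algebraType ballsK.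

End LocalFieldCarrier.

Definition qpow {R : realType} (q : nat) (k : int) : R := (q%:R : R) `^ (k%:~R).

(* Axioms satisfied by a non-Archimedean local field K, its normalized
   absolute value absK (values q^N, q = cardinality of the residue field),
   and its Haar measure mu normalized by mu {|x|_K <= 1} = 1. *)
Record local_field_data (R : realType) (K : fieldType) (q : nat)
    (absK : K -> R) (mu : {measure set (KBorel absK) -> \bar R}) : Prop := {
  lf_q : (2 <= q)%N;
  lf_abs0 : forall x : K, absK x = 0 <-> x = 0;
  lf_absM : forall x y : K, absK (x * y) = absK x * absK y;
  lf_ultra : forall x y : K, absK (x + y) <= Num.max (absK x) (absK y);
  lf_values : forall x : K, x != 0 -> exists N : int, absK x = qpow q N;
  lf_uniformizer : exists pi : K, absK pi = (q%:R)^-1;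
  lf_translation : forall (a : K) (A : set (KBorel absK)), measurable A ->
     mu [set ((a + (x : K)) : KBorel absK) | x in A] = mu A;
  lf_scaling : forall (a : K) (A : set (KBorel absK)), measurable A ->
     mu [set ((a * (x : K)) : KBorel absK) | x in A] = ((absK a)%:E * mu A)%E;
  lf_normalized : mu [set x : KBorel absK | absK (x : K) <= 1] = 1%E
}.

Section Operators.
Variables (R : realType) (K : fieldType) (q : nat) (absK : K -> R)
  (mu : {measure set (KBorel absK) -> \bar R}) (alpha : R).

Let qR : R := q%:R.

(* the operator I^alpha on radial functions v = v(|x|_K); returns the
   radial function (I^alpha v)(r), r = |x|_K *)
Definition Ialpha (v : R -> R) (r : R) : R :=
  if r == 0 then 0 else
  if alpha == 1 then
    qR^-1 * r * v r +
    (1 - qR) / (qR * ln qR) *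
      Rintegral mu [set y : KBorel absK | absK (y : K) < r]
        (fun y : KBorel absK => (ln r - ln (absK (y : K))) * v (absK (y : K)))
  else
    qR `^ (- alpha) * r `^ alpha * v r +
    (1 - qR `^ (- alpha)) / (1 - qR `^ (alpha - 1)) *
      Rintegral mu [set y : KBorel absK | absK (y : K) < r]
        (fun y : KBorel absK =>
           (r `^ (alpha - 1) - (absK (y : K)) `^ (alpha - 1)) * v (absK (y : K))).

Definition Dalpha_integrand (U : R -> R) (x : K) (y : KBorel absK) : R :=
  (absK (y : K)) `^ (- alpha - 1) * (U (absK (x - (y : K))) - U (absK x)).

(* (D^alpha u)(x) for x <> 0 *)
Definition Dalpha (U : R -> R) (x : K) : R :=
  (1 - qR `^ alpha) / (1 - qR `^ (- alpha - 1)) *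
    Rintegral mu setT (Dalpha_integrand U x).

Definition radial_continuous (U : R -> R) : Prop :=
  forall x0 : K, forall e : R, 0 < e -> exists2 d : R, 0 < d &
    forall x : K, absK (x - x0) < d -> `|U (absK x) - U (absK x0)| < e.

Definition Dalpha_summable (U : R -> R) : Prop :=
  exists m : int,
    (\sum_(0 <= n <oo) (qpow q (m - n%:Z) * `|U (qpow q (m - n%:Z))|)%:E < +oo)%E /\
    (\sum_(0 <= n <oo) ((qpow q (m + n%:Z)) `^ (- alpha)
                         * `|U (qpow q (m + n%:Z))|)%:E < +oo)%E.

(* D^alpha u is defined in the strong sense, with value L at 0 *)
Definition Dalpha_strong (U : R -> R) (L : R) : Prop :=
  Dalpha_summable U /\
  (forall x : K, x != 0 -> mu.-integrable setT (fun y => (Dalpha_integrand U x y)%:E)) /\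
  (forall e : R, 0 < e -> exists2 d : R, 0 < d &
     forall x : K, x != 0 -> absK x < d -> `|Dalpha U x - L| < e).

Definition strong_solution (U a f : R -> R) : Prop :=
  radial_continuous U /\
  exists L : R, Dalpha_strong U L /\
    (forall x : K, x != 0 -> Dalpha U x + a (absK x) * U (absK x) = f (absK x)) /\
    L + a 0 * U 0 = f 0 /\
    U 0 = 0.

End Operators.

(* Main.v *)
(* With Q = q, X = q^alpha and V k the value of v at radius Q^k, integration over
   spheres turns I^alpha into a one-sided convolution, (I^alpha v)(Q^n) = X^n s_n,
   where s_n is a combination of V_n and of the sequences p_n = V_n + p_{n-1} / Q
   and r_n = V_n + r_{n-1} / X (for alpha = 1, where X = Q, r is replaced by the
   convolution of p_{n-1} / Q with Q^{-j}). D^alpha becomes a two-sided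
   convolution in s, both halves of which have closed forms in p, r and V, found
   from first order recurrences, so that D^alpha I^alpha v = v reduces to rational
   identities as soon as V is summable at infinity. For the summability,
   |s_n| <= G sup_{k <= n} |V_k| and the decay of a and f give
   |V_n| <= C q^{-n eps} (1 + G sup_{k <= n} |V_k|): hence V is bounded, and then
   V_n = O(q^{-n eps}). *)
Require Import Defs.
From HB Require Import structures.
From mathcomp Require Import all_boot all_order all_algebra.
From mathcomp Require Import all_classical all_reals all_analysis.
From mathcomp Require Import measurable_realfun.
From mathcomp Require Import zify ring lra.
Import Order.TTheory GRing.Theory Num.Theory.
Import numFieldNormedType.Exports.
Local Open Scope classical_set_scope.
Local Open Scope ring_scope.

Set Implicit Arguments.
Unset Strict Implicit.
Unset Printing Implicit Defensive.

(** * Integration over spheres *)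

Lemma integrable_disjointU d (T : measurableType d) (R : realType)
    (mu : {measure set T -> \bar R}) (A B : set T) (f : T -> \bar R) :
  measurable A -> measurable B -> [disjoint A & B] ->
  mu.-integrable A f -> mu.-integrable B f -> mu.-integrable (A `|` B) f.
Proof.
move=> mA mB dAB /integrableP[fA iA] /integrableP[fB iB].
have mf : measurable_fun (A `|` B) f by apply/measurable_funU.
apply/integrableP; split => //; rewrite ge0_integral_setU //.
  exact: lte_add_pinfty.
exact: measurableT_comp.
Qed.

Section step_functions.
Context d (T : measurableType d) (R : realType) (mu : {measure set T -> \bar R}).
Variables (A : nat -> set T) (c m : nat -> R) (F : T -> R).
Hypotheses (tA : trivIset setT A) (mA : forall i, measurable (A i)).
Hypotheses (muA : forall i, mu (A i) = (m i)%:E).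
Hypotheses (FA : forall i x, A i x -> F x = c i).

Lemma step_measurable : measurable_fun (\bigcup_i A i) F.
Proof.
apply/measurable_fun_bigcup => // i.
apply: (eq_measurable_fun (cst (c i))); last exact: measurable_cst.
by move=> x /set_mem /FA ->.
Qed.

(** Bounding the partial sums is enough: the terms are nonnegative, so the bound passes to the
    series that countable additivity of the integral produces. *)
Lemma step_integrable (B : R) :
  (forall N, \sum_(0 <= i < N) `|c i| * m i <= B) ->
  mu.-integrable (\bigcup_i A i) (EFin \o F).
Proof.
move=> hB; apply/integrableP; split.
  by apply/measurable_EFinP; exact: step_measurable.
rewrite ge0_integral_bigcup //=; last first.
  apply/measurable_EFinP; apply: measurableT_comp => //; exact: step_measurable.
apply: (@le_lt_trans _ _ B%:E); last exact: ltry.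
under eq_eseriesr => i _.
  rewrite (eq_integral (cst (`|c i|)%:E)); last first.
    by move=> x /set_mem /FA ->.
  rewrite integral_cst // muA.
  over.
apply: lime_le.
  by apply: is_cvg_nneseries => i _ _; rewrite -muA mule_ge0.
by apply: nearW => N; rewrite sumEFin lee_fin.
Qed.

Lemma step_Rintegral (B S : R) :
  (forall N, \sum_(0 <= i < N) `|c i| * m i <= B) ->
  \sum_(0 <= i < N) c i * m i @[N --> \oo] --> S ->
  \int[mu]_(x in \bigcup_i A i) F x = S.
Proof.
move=> /step_integrable iF hS; rewrite /Rintegral integral_bigcup //.
under eq_eseriesr => i _.
  rewrite (eq_integral (cst (c i)%:E)); last first.
    by move=> x /set_mem /FA ->.
  rewrite integral_cst // muA.
  over.
suff -> : (\sum_(0 <= i <oo) (c i)%:E * (m i)%:E)%E = S%:E by [].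
apply/cvg_lim => //.
under eq_fun do rewrite sumEFin.
by apply: (cvg_comp _ _ hS); exact: continuous_cvg.
Qed.

End step_functions.

Lemma qpowE (R : realType) (q : nat) (k : int) : qpow q k = (q%:R : R) ^ k.
Proof. by rewrite /qpow powR_intmul // ler0n. Qed.

Section local_field.
Context (R : realType) (K : fieldType) (q : nat) (absK : K -> R)
  (mu : {measure set (KBorel absK) -> \bar R}).
Hypothesis HK : local_field_data q mu.

Local Notation Q := (q%:R : R).

Lemma q_gt1 : 1 < Q. Proof. by rewrite ltr1n; exact: lf_q HK. Qed.
Let Q0 : 0 < Q := lt_trans ltr01 q_gt1.

Lemma absK0 : absK 0 = 0. Proof. exact/(lf_abs0 HK). Qed.

Lemma absK_val (x : K) : x != 0 -> exists k : int, absK x = Q ^ k.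
Proof. by move=> /(lf_values HK)[k ->]; exists k; rewrite qpowE. Qed.

Lemma absK_gt0 (x : K) : x != 0 -> 0 < absK x.
Proof. by move=> /absK_val[k ->]; rewrite exprz_gt0. Qed.

Lemma absK_ge0 (x : K) : 0 <= absK x.
Proof. by have [->|/absK_gt0/ltW//] := eqVneq x 0; rewrite absK0. Qed.

Lemma absK1 : absK 1 = 1.
Proof.
have h : absK 1 != 0 by rewrite gt_eqF // absK_gt0 // oner_eq0.
by apply: (mulfI h); rewrite mulr1 -(lf_absM HK) mulr1.
Qed.

Lemma absKN (x : K) : absK (- x) = absK x.
Proof.
have h : absK (-1) = 1.
  apply/eqP; rewrite -(@eqrXn2 _ 2) ?absK_ge0 //.
  by rewrite expr2 -(lf_absM HK) mulrNN mulr1 absK1 expr1n.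
by rewrite -mulN1r (lf_absM HK) h mul1r.
Qed.

Lemma absKBC (x y : K) : absK (x - y) = absK (y - x).
Proof. by rewrite -absKN opprB. Qed.

(** The strict case of the ultrametric inequality: writing y as -x + (x + y) shows that |x + y|
    cannot drop below |y|. *)
Lemma absKD_eq (x y : K) : absK x < absK y -> absK (x + y) = absK y.
Proof.
move=> xy; apply/eqP; rewrite eq_le; apply/andP; split.
  by apply: le_trans (lf_ultra HK x y) _; rewrite (max_idPr (ltW xy)).
have := lf_ultra HK (- x) (x + y); rewrite addKr absKN le_max.
by rewrite leNgt xy.
Qed.

Lemma absK_exists (k : int) : exists x : K, absK x = Q ^ k.
Proof.
have [p hp] := lf_uniformizer HK.
have p0 : p != 0.
  by apply/eqP => /(lf_abs0 HK); rewrite hp => /eqP; rewrite invr_eq0 gt_eqF.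
have hn (n : nat) : absK (p ^+ n) = Q ^- n.
  elim: n => [|n IH]; first by rewrite !expr0 absK1 invr1.
  by rewrite !exprS (lf_absM HK) IH hp invfM.
(* The uniformizer has absolute value 1/q, so nonnegative exponents come from inverses of its
   powers. *)
case: k => n; last by exists (p ^+ n.+1); rewrite hn.
exists (p ^+ n)^-1.
have u : absK (p ^+ n) != 0 by rewrite hn invr_eq0 expf_neq0 // gt_eqF.
apply: (mulfI u); rewrite -(lf_absM HK) divff ?expf_neq0 // absK1 hn.
by rewrite mulVf // expf_neq0 // gt_eqF.
Qed.

Definition ballK (c : K) (r : R) : set (KBorel absK) :=
  [set y | absK ((y : K) - c) <= r].

Definition sphereK (c : K) (k : int) : set (KBorel absK) :=
  [set y | absK ((y : K) - c) = Q ^ k].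

Lemma measurable_ballK c r : measurable (ballK c r).
Proof. by apply: sub_sigma_algebra; exists c, r. Qed.

(** The ball is the unit ball scaled by an element of absolute value Q^k and then translated by
    c. *)
Lemma mu_ballK c (k : int) : mu (ballK c (Q ^ k)) = (Q ^ k)%:E.
Proof.
have [z hz] := absK_exists k.
have z0 : z != 0.
  by apply/eqP => /(lf_abs0 HK); rewrite hz => /eqP; rewrite gt_eqF // exprz_gt0.
have Qk : 0 < Q ^ k by rewrite exprz_gt0.
have h0 : measurable (ballK 0 1) by exact: measurable_ballK.
have hk : [set ((z * (x : K)) : KBorel absK) | x in ballK 0 1] = ballK 0 (Q ^ k).
  apply/seteqP; split => [_ [y hy <-]|y].
    move: hy; rewrite /ballK /= !subr0 => hy; rewrite (lf_absM HK) hz.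
    by rewrite ler_piMr // ltW.
  rewrite /ballK /= subr0 => hy; exists (z^-1 * (y : K)); last by rewrite mulVKf.
  rewrite subr0 -(ler_pM2l Qk) mulr1 -hz -(lf_absM HK) mulVKf //.
  by rewrite hz.
have hc : [set ((c + (x : K)) : KBorel absK) | x in ballK 0 (Q ^ k)] =
    ballK c (Q ^ k).
  apply/seteqP; split => [_ [y hy <-]|y].
    by move: hy; rewrite /ballK /= subr0 addrC addKr.
  rewrite /ballK /= => hy; exists ((y : K) - c); first by rewrite /= subr0.
  by rewrite addrC subrK.
rewrite -hc (lf_translation HK); last exact: measurable_ballK.
have := lf_scaling HK z h0; rewrite hk hz => ->.
have -> : ballK 0 1 = [set x : KBorel absK | absK (x : K) <= 1].
  by apply/seteqP; split => y; rewrite /ballK /= subr0.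
by rewrite (lf_normalized HK) mule1.
Qed.

(** No absolute value lies strictly between Q^(k-1) and Q^k. *)
Lemma sphereKE c k : sphereK c k = ballK c (Q ^ k) `\` ballK c (Q ^ (k - 1)).
Proof.
have h : Q ^ (k - 1) < Q ^ k by rewrite ltr_eXz2l ?q_gt1 // ltrBlDr ltrDl.
apply/seteqP; split => y; rewrite /sphereK /ballK /=.
  by move=> ->; split => //; apply/negP; rewrite -ltNge.
move=> [le1 /negP]; rewrite -ltNge.
have [/eqP|/absK_val[j hj]] := eqVneq ((y : K) - c) 0.
  by move=> /eqP ->; rewrite absK0 ltNge ltW // exprz_gt0.
rewrite hj in le1 *; rewrite ltr_eXz2l ?q_gt1 // => h2.
move: le1; rewrite ler_eXz2l ?q_gt1 // => h3.
by congr (Q ^ _); lia.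
Qed.

Lemma measurable_sphereK c k : measurable (sphereK c k).
Proof. by rewrite sphereKE; apply: measurableD; exact: measurable_ballK. Qed.

Lemma mu_sphereK c k : mu (sphereK c k) = ((1 - Q^-1) * Q ^ k)%:E.
Proof.
have fin : (mu (ballK c (Q ^ k)) < +oo)%E by rewrite mu_ballK ltry.
have -> : mu (sphereK c k) =
    (mu (ballK c (Q ^ k)) - mu (ballK c (Q ^ k) `&` ballK c (Q ^ (k - 1))))%E.
  rewrite sphereKE; exact: (measureD (measurable_ballK _ _) (measurable_ballK _ _) fin).
rewrite setIidr; last first.
  move=> y; rewrite /ballK /= => /le_trans; apply.
  by rewrite ler_eXz2l ?q_gt1 // gerBl.
rewrite !mu_ballK -EFinB; congr EFin.
rewrite expfzDr ?gt_eqF // exprN1; ring.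
Qed.

(** As a ball of radius 0, a point is measurable: the generating balls have arbitrary real radii. *)
Lemma set1K (c : K) : [set (c : KBorel absK)] = ballK c 0.
Proof.
apply/seteqP; split => y; rewrite /ballK /=.
  by move=> ->; rewrite subrr absK0.
move=> h; apply/eqP; rewrite -subr_eq0; apply/eqP/(lf_abs0 HK)/eqP.
by rewrite eq_le h absK_ge0.
Qed.

(** Multiplication by a uniformizer fixes {0} and divides its mass by q; this mass is finite since
    {0} lies in the unit ball, so it is 0. *)
Lemma mu_set1K (c : K) : mu [set (c : KBorel absK)] = 0.
Proof.
have [z hz] := lf_uniformizer HK.
have m1 (e : K) : measurable [set (e : KBorel absK)].
  by rewrite set1K; exact: measurable_ballK.
have -> : [set (c : KBorel absK)] =
    [set ((c + (x : K)) : KBorel absK) | x in [set (0 : K)]].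
  by rewrite image_set1 addr0.
rewrite (lf_translation HK) //.
have := lf_scaling HK z (m1 0); rewrite image_set1 mulr0 hz.
have : (mu [set (0%R : KBorel absK)] <= 1)%E.
  rewrite -(lf_normalized HK); apply: le_measure; rewrite ?inE.
  - exact: m1.
  - have := measurable_ballK 0 1.
    by congr measurable; apply/seteqP; split => y; rewrite /ballK /= subr0.
  - by move=> y ->; rewrite /= absK0.
have : (0 <= mu [set (0%R : KBorel absK)])%E by exact: measure_ge0.
case: (mu _) => [r| |] //; rewrite !lee_fin -EFinM => r0 r1 [h].
suff -> : r = 0 by [].
have q1 := q_gt1; apply/eqP/negPn/negP => rn0.
have : Q^-1 = 1 by apply: (mulIf rn0); rewrite -h mul1r.
move=> /(congr1 (fun x => x^-1)); rewrite invrK invr1; lra.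
Qed.

End local_field.

Section radial_integrals.
Context (R : realType) (K : fieldType) (q : nat) (absK : K -> R)
  (mu : {measure set (KBorel absK) -> \bar R}).
Hypothesis HK : local_field_data q mu.

Local Notation Q := (q%:R : R).
Local Notation b := (1 - Q^-1).
Local Notation S_ := (@sphereK R K q absK).
Let Q0 : 0 < Q := lt_trans ltr01 (q_gt1 HK).

Lemma sphereK_disjoint c k l y : S_ c k y -> S_ c l y -> k = l.
Proof.
rewrite /sphereK /= => -> /ieexprIz; apply; first exact: Q0.
by rewrite gt_eqF // (q_gt1 HK).
Qed.

Variables (c : K) (n : int) (F : KBorel absK -> R) (w : nat -> R) (B S : R).

(* [w 0 = 0] because the term j = 0 stands for the null set {c}, where F is arbitrary. *)
Lemma integral_openball :
  w 0 = 0 ->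
  (forall j y, (0 < j)%N -> absK ((y : K) - c) = Q ^ (n - j%:Z) -> F y = w j) ->
  (forall N, \sum_(0 <= j < N) `|w j| * (b * Q ^ (n - j%:Z)) <= B) ->
  \sum_(0 <= j < N) w j * (b * Q ^ (n - j%:Z)) @[N --> \oo] --> S ->
  let D := [set y : KBorel absK | absK ((y : K) - c) < Q ^ n] in
  [/\ measurable D, mu.-integrable D (EFin \o F) & \int[mu]_(y in D) F y = S].
Proof.
move=> w0 Fw hB hS D.
pose A j : set (KBorel absK) := if j is j'.+1 then S_ c (n - j%:Z) else [set c].
pose e j := if j is j'.+1 then w j else F c.
pose m j := if j is j'.+1 then b * Q ^ (n - j%:Z) else 0.
have DA : D = \bigcup_j A j.
  apply/seteqP; split => y; rewrite /D /=.
    have [/eqP|/(absK_val HK)[k hk]] := eqVneq ((y : K) - c) 0.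
      by rewrite subr_eq0 => /eqP -> _; exists 0%N.
    rewrite hk ltr_eXz2l ?(q_gt1 HK) // => kn; exists `|n - k|%N => //.
    have : (0 < `|n - k|)%N by lia.
    have : k = n - `|n - k|%:Z by lia.
    rewrite /A; case: `|n - k|%N => // j hj _; rewrite /sphereK /= -hj //.
  move=> [[|j] _]; rewrite /A /= ?/sphereK /=.
    by move=> ->; rewrite subrr (absK0 HK) exprz_gt0.
  by move=> ->; rewrite ltr_eXz2l ?(q_gt1 HK) //; lia.
have mA j : measurable (A j).
  case: j => [|j]; last exact: (measurable_sphereK HK).
  by rewrite /A (set1K HK); exact: measurable_ballK.
have tA : trivIset setT A.
  have c0 y j : y = c -> A j y -> j = 0%N.
    move=> ->; case: j => //= j; rewrite /sphereK /= subrr (absK0 HK).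
    by move=> /eqP; rewrite eq_sym gt_eqF // exprz_gt0.
  move=> i j _ _ [y []]; case: i => [yc /(c0 _ _ yc)//|i].
  case: j => [h yc|j]; first by move/(c0 _ _ yc) : h.
  move=> h1 h2; have : n - i.+1%:Z = n - j.+1%:Z := sphereK_disjoint h1 h2.
  lia.
have muA j : mu (A j) = (m j)%:E.
  by case: j => [|j]; [exact: (mu_set1K HK) | exact: (mu_sphereK HK)].
have FA j y : A j y -> F y = e j.
  by case: j => [->//|j]; exact: Fw.
have me j : e j * m j = w j * (b * Q ^ (n - j%:Z)).
  by case: j => //; rewrite w0 mul0r mulr0.
have me' j : `|e j| * m j = `|w j| * (b * Q ^ (n - j%:Z)).
  by case: j => //; rewrite w0 normr0 mul0r mulr0.
have hB' N : \sum_(0 <= j < N) `|e j| * m j <= B.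
  by under eq_bigr do rewrite me'.
have hS' : \sum_(0 <= j < N) e j * m j @[N --> \oo] --> S.
  by under eq_fun do under eq_bigr do rewrite me.
rewrite DA; split.
- exact: bigcup_measurable.
- exact: (step_integrable tA mA muA FA hB').
- exact: (step_Rintegral tA mA muA FA hB' hS').
Qed.

Lemma integral_ballC :
  (forall j y, absK ((y : K) - c) = Q ^ (n + j%:Z) -> F y = w j) ->
  (forall N, \sum_(0 <= j < N) `|w j| * (b * Q ^ (n + j%:Z)) <= B) ->
  \sum_(0 <= j < N) w j * (b * Q ^ (n + j%:Z)) @[N --> \oo] --> S ->
  let D := [set y : KBorel absK | Q ^ n <= absK ((y : K) - c)] in
  [/\ measurable D, mu.-integrable D (EFin \o F) & \int[mu]_(y in D) F y = S].
Proof.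
move=> Fw hB hS D.
pose A j : set (KBorel absK) := S_ c (n + j%:Z).
have DA : D = \bigcup_j A j.
  apply/seteqP; split => y; rewrite /D /=.
    have [->|/(absK_val HK)[k hk]] := eqVneq ((y : K) - c) 0.
      by rewrite (absK0 HK) leNgt exprz_gt0.
    rewrite hk ler_eXz2l ?(q_gt1 HK) // => kn; exists `|k - n|%N => //.
    by rewrite /A /sphereK /= hk; congr (_ ^ _); lia.
  move=> [j _]; rewrite /A /= ?/sphereK /= => ->.
  by rewrite ler_eXz2l ?(q_gt1 HK) //; lia.
have mA j : measurable (A j) by exact: (measurable_sphereK HK).
have tA : trivIset setT A.
  move=> i j _ _ [y [h1 h2]].
  have : n + i%:Z = n + j%:Z := sphereK_disjoint h1 h2.
  lia.
have muA j : mu (A j) = (b * Q ^ (n + j%:Z))%:E by exact: (mu_sphereK HK).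
rewrite DA; split.
- exact: bigcup_measurable.
- exact: (step_integrable tA mA muA Fw hB).
- exact: (step_Rintegral tA mA muA Fw hB hS).
Qed.

End radial_integrals.

(** * Convolution of two-sided sequences with geometric kernels *)

Section two_sided_sequences.
Variable R : realType.
Implicit Types (u V p r s : int -> R) (c x : R) (n : int) (N : nat).

Lemma cvg_eq_lim (w : nat -> R) (a b : R) : a = b ->
  w N @[N --> \oo] --> a -> w N @[N --> \oo] --> b.
Proof. by move=> ->. Qed.

Lemma sum_geometric_le x N : 0 <= x -> x < 1 ->
  \sum_(0 <= j < N) x ^+ j <= (1 - x)^-1.
Proof.
move=> x0 x1; have := geometric_seriesE 1 (negbT (lt_eqF x1)).
move=> /(congr1 (fun u : nat -> R => u N)); rewrite /series /= /geometric /=.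
under eq_bigr do rewrite mul1r.
move=> ->; rewrite mul1r ler_piMl //; first by rewrite invr_ge0 subr_ge0 ltW.
by rewrite gerBl exprn_ge0.
Qed.

Lemma cvg_sum_geometric x : 0 <= x -> x < 1 ->
  \sum_(0 <= j < N) x ^+ j @[N --> \oo] --> (1 - x)^-1.
Proof.
move=> x0 x1; have := @cvg_geometric_series _ 1 x; rewrite ger0_norm // mul1r.
move=> /(_ x1); rewrite /series /geometric /=.
by under eq_fun do under eq_bigr do rewrite mul1r.
Qed.

Lemma cvg_series_bounded (u : nat -> R) B :
  (forall N, \sum_(0 <= j < N) `|u j| <= B) -> cvgn (series u).
Proof.
move=> hB; apply: normed_cvg; apply: nondecreasing_is_cvgn.
  by apply: (@nondecreasing_series _ (fun j => `|u j|) xpredT 0) => j _ _; exact: normr_ge0.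
by exists B => _ [N _ <-]; exact: hB.
Qed.

(** Encodes |u n| <= G sup_{k <= n} |V k|, with G uniform in n, without forming the supremum. *)
Definition dominated V u := exists G, forall n M,
  (forall k, k <= n -> `|V k| <= M) -> `|u n| <= G * M.

Definition left_bounded V := forall n, exists M, forall k, k <= n -> `|V k| <= M.

Definition right_summable V :=
  forall n, exists B, forall N, \sum_(0 <= j < N) `|V (n + j%:Z)| <= B.

Lemma dominated_refl V : dominated V V.
Proof. by exists 1 => n M h; rewrite mul1r h. Qed.

Lemma dominatedD V s r : dominated V s -> dominated V r ->
  dominated V (fun n => s n + r n).
Proof.
move=> [G hG] [H hH]; exists (G + H) => n M h.
by rewrite mulrDl; apply: le_trans (ler_normD _ _) (lerD (hG _ _ h) (hH _ _ h)).
Qed.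

Lemma dominatedZ V s c : dominated V s -> dominated V (fun n => c * s n).
Proof.
move=> [G hG]; exists (`|c| * G) => n M h.
by rewrite normrM -mulrA ler_wpM2l // hG.
Qed.

Lemma dominated_pred V s : dominated V s -> dominated V (fun n => s (n - 1)).
Proof.
move=> [G hG]; exists G => n M h; apply: hG => k hk; apply: h.
by apply: le_trans hk _; rewrite gerBl.
Qed.

Lemma dominated_left V s : left_bounded V -> dominated V s -> left_bounded s.
Proof.
move=> hV [G hG] n; have [M hM] := hV n; exists (G * M) => k kn.
by apply: hG => l lk; apply: hM; exact: le_trans kn.
Qed.

Lemma dominated_trans V s r : left_bounded V ->
  dominated V s -> dominated s r -> dominated V r.
Proof.
move=> hV [G hG] [H hH]; exists (H * G) => n M h.
rewrite -mulrA; apply: hH => k kn; apply: hG => l lk; apply: h.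
exact: le_trans kn.
Qed.

Lemma right_summableD s r : right_summable s -> right_summable r ->
  right_summable (fun n => s n + r n).
Proof.
move=> hs hr n; have [B hB] := hs n; have [C hC] := hr n.
exists (B + C) => N; apply: le_trans (lerD (hB N) (hC N)).
by rewrite -big_split; apply: ler_sum => j _; exact: ler_normD.
Qed.

Lemma right_summableZ s c : right_summable s -> right_summable (fun n => c * s n).
Proof.
move=> hs n; have [B hB] := hs n; exists (`|c| * B) => N.
under eq_bigr do rewrite normrM.
by rewrite -mulr_sumr ler_wpM2l.
Qed.

Lemma right_summable_pred s : right_summable s ->
  right_summable (fun n => s (n - 1)).
Proof.
move=> hs n; have [B hB] := hs (n - 1); exists B => N.
by under eq_bigr do rewrite addrAC.
Qed.

Lemma right_summable_cvg0 s n : right_summable s ->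
  s (n + N%:Z) @[N --> \oo] --> 0.
Proof.
move=> /(_ n)[B hB]; apply: cvg_series_cvg_0; exact: cvg_series_bounded hB.
Qed.

(** The recurrence turns the partial sums into T n - T (n + N). *)
Lemma telescope_cvg s T n : (forall n, T n = s n + T (n + 1)) ->
  T (n + N%:Z) @[N --> \oo] --> 0 ->
  \sum_(0 <= j < N) s (n + j%:Z) @[N --> \oo] --> T n.
Proof.
move=> hT T0.
have -> : (fun N => \sum_(0 <= j < N) s (n + j%:Z)) = (fun N => T n - T (n + N%:Z)).
  apply/funext; elim=> [|N IH]; first by rewrite big_nil addr0 subrr.
  rewrite big_nat_recr //= IH hT [in X in _ - X + _]hT intS [1 + _]addrC addrA.
  ring.
by apply: (cvg_eq_lim (subr0 _)); apply: cvgB => //; exact: cvg_cst.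
Qed.

Section geometric_convolution.
Variable c : R.
Hypothesis c1 : 1 < c.

Let c0 : 0 < c := lt_trans ltr01 c1.
Let ci0 : 0 <= c^-1. Proof. by rewrite invr_ge0 ltW. Qed.
Let ci1 : c^-1 < 1. Proof. by rewrite invf_lt1. Qed.

(** [p n] is the sum of c^-j V (n - j) over j >= 0, controlled by a geometric series because V is
    bounded to the left. *)
Lemma conv_exists V : left_bounded V -> exists p,
  (forall n, p n = V n + p (n - 1) / c) /\ dominated V p.
Proof.
move=> hV.
pose t n (j : nat) := c^-1 ^+ j * V (n - j%:Z).
have tB n M N : (forall k, k <= n -> `|V k| <= M) ->
    \sum_(0 <= j < N) `|t n j| <= (1 - c^-1)^-1 * M.
  move=> hM; have M0 : 0 <= M by apply: le_trans (hM n _).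
  apply: (@le_trans _ _ (\sum_(0 <= j < N) c^-1 ^+ j * M)).
    apply: ler_sum => j _; rewrite normrM ger0_norm ?exprn_ge0 //.
    by rewrite ler_wpM2l ?exprn_ge0 // hM // gerBl.
  by rewrite -mulr_suml ler_wpM2r // sum_geometric_le.
have tC n : cvgn (series (t n)).
  by have [M hM] := hV n; apply: cvg_series_bounded => N; exact: tB hM.
exists (fun n => limn (series (t n))); split => [n|].
  (* Splitting off the term j = 0 leaves 1/c times the series at n - 1; uniqueness of limits gives
     the recurrence. *)
  have h1 := tC n; have h2 := tC (n - 1).
  apply: (@cvg_unique _ _ (series (t n) (N.+1) @[N --> \oo])) => //.
    by move: h1; rewrite -cvg_shiftS.
  have -> : (fun N => series (t n) N.+1) = (fun N => V n + series (t (n - 1)) N / c).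
    apply/funext => N; rewrite /series /= big_nat_recl //.
    rewrite /t expr0 mul1r subr0 mulr_suml; congr (_ + _).
    apply: eq_bigr => j _; rewrite exprSr.
    have -> : n - j.+1%:Z = n - 1 - j%:Z by lia.
    by rewrite mulrAC.
  by apply: cvgD; [exact: cvg_cst | apply: cvgM => //; exact: cvg_cst].
exists (1 - c^-1)^-1 => n M hM.
apply: (cvgr_to_le (cvg_norm (tC n))); apply: nearW => N.
by apply: le_trans (ler_norm_sum _ _ _) (tB _ _ _ hM).
Qed.

Lemma cvg0M_bounded (u v : nat -> R) M : u N @[N --> \oo] --> 0 ->
  (forall N, `|v N| <= M) -> u N * v N @[N --> \oo] --> 0.
Proof.
move=> u0 vM; apply/norm_cvg0P.
apply: (@squeeze_cvgr _ _ _ _ (fun=> 0) (fun N => `|u N| * M)).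
- by apply: nearW => N; rewrite normr_ge0 normrM ler_wpM2l.
- exact: cvg_cst.
- apply: (@cvg_eq_lim _ (`|0 : R| * M)); first by rewrite normr0 mul0r.
  by apply: cvgM; [exact: cvg_norm | exact: cvg_cst].
Qed.

Lemma cvg_geometric0 : c^-1 ^+ N @[N --> \oo] --> 0.
Proof. by apply: cvg_expr; rewrite ger0_norm. Qed.

Variables V p : int -> R.
Hypothesis hp : forall n, p n = V n + p (n - 1) / c.

(** Iterating the recurrence N times leaves an explicit remainder, which vanishes in the limit when
    p is bounded to the left. *)
Lemma conv_sum n N :
  \sum_(0 <= j < N) c^-1 ^+ j * V (n - j%:Z) = p n - c^-1 ^+ N * p (n - N%:Z).
Proof.
elim: N => [|N IH]; first by rewrite big_nil mul1r subr0 subrr.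
rewrite big_nat_recr //= IH (hp (n - N%:Z)) exprSr.
have -> : n - N.+1%:Z = n - N%:Z - 1 by lia.
ring.
Qed.

Lemma conv_cvg n : left_bounded p ->
  \sum_(0 <= j < N) c^-1 ^+ j * V (n - j%:Z) @[N --> \oo] --> p n.
Proof.
move=> /(_ n)[M hM]; under eq_fun do rewrite conv_sum.
apply: (cvg_eq_lim (subr0 _)); apply: cvgB; first exact: cvg_cst.
by apply: cvg0M_bounded cvg_geometric0 _ => N; apply: hM; rewrite gerBl.
Qed.

(** With S a partial sum of |p|, the recurrence gives S <= B + (|p (n - 1)| + S) / c, which can be
    solved for S since c > 1. *)
Lemma conv_right_summable : right_summable V -> right_summable p.
Proof.
move=> hV n; have [B hB] := hV n.
exists ((B + `|p (n - 1)| / c) / (1 - c^-1)) => N.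
rewrite ler_pdivlMr ?subr_gt0 // mulrBr mulr1 lerBlDr -addrA -mulrDl.
have h j : `|p (n + j%:Z)| <= `|V (n + j%:Z)| + `|p (n + j%:Z - 1)| / c.
  by rewrite hp; apply: le_trans (ler_normD _ _) _; rewrite normrM (ger0_norm ci0).
apply: le_trans (ler_sum _ (fun j _ => h j)) _; rewrite big_split /=.
apply: lerD => //; rewrite -mulr_suml ler_wpM2r //.
have -> : \sum_(0 <= j < N) `|p (n + j%:Z - 1)| <= `|p (n - 1)| +
    \sum_(0 <= j < N) `|p (n + j%:Z)| => //.
apply: (@le_trans _ _ (\sum_(0 <= j < N.+1) `|p (n + j%:Z - 1)|)).
  by rewrite big_nat_recr //= lerDl.
rewrite big_nat_recl // addr0 lerD2l; apply: ler_sum => j _.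
by have -> : n + j.+1%:Z - 1 = n + j%:Z by lia.
Qed.

Variable r : int -> R.
Hypothesis hr : forall n, r n = p (n - 1) / c + r (n - 1) / c.

(** A second convolution with the same ratio turns the weights c^-j into j c^-j, since j counts the
    ways to split j into a positive and a nonnegative part. *)
Lemma conv_moment_sum n N :
  \sum_(0 <= j < N) j%:R * c^-1 ^+ j * V (n - j%:Z) =
  r n - c^-1 ^+ N * r (n - N%:Z) - N%:R * c^-1 ^+ N * p (n - N%:Z).
Proof.
elim: N => [|N IH]; first by rewrite big_nil expr0 !mul1r !mul0r !subr0 subrr.
rewrite big_nat_recr //= IH (hp (n - N%:Z)) (hr (n - N%:Z)) exprSr -natr1.
have -> : n - N.+1%:Z = n - N%:Z - 1 by lia.
ring.
Qed.

End geometric_convolution.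

Lemma moment_bounded c : 1 < c ->
  exists B, forall N, \sum_(0 <= j < N) j%:R * c^-1 ^+ j <= B.
Proof.
move=> c1; have c0 : 0 < c := lt_trans ltr01 c1.
have cn : c != 0 by rewrite gt_eqF.
have cn1 : c - 1 != 0 by rewrite subr_eq0 gt_eqF.
(* The full sums of c^-j and of j c^-j, which are the constant solutions of the two recurrences for
   V = 1. The remainders are then nonnegative. *)
pose p (n : int) : R := c / (c - 1); pose r (n : int) : R := c / (c - 1) ^+ 2.
have hp n : p n = 1 + p (n - 1) / c by rewrite /p; field; rewrite cn cn1.
have hr n : r n = p (n - 1) / c + r (n - 1) / c.
  by rewrite /p /r; field; rewrite cn cn1.
exists (c / (c - 1) ^+ 2) => N.
have := @conv_moment_sum c c1 (fun=> 1) p hp r hr 0 N.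
under eq_bigr do rewrite mulr1.
move=> ->; rewrite -addrA -opprD gerBl addr_ge0 ?mulr_ge0 ?exprn_ge0 //.
all: rewrite ?invr_ge0 ?exprn_ge0 ?subr_ge0 ?ltW //.
Qed.

Lemma cvg_moment0 c : 1 < c -> N%:R * c^-1 ^+ N @[N --> \oo] --> 0.
Proof.
move=> c1; have [B hB] := moment_bounded c1.
apply: cvg_series_cvg_0; apply: (@cvg_series_bounded _ B) => N.
have ci0 : 0 <= c^-1 by rewrite invr_ge0 ltW // (lt_trans ltr01).
under eq_bigr => j _ do rewrite ger0_norm ?mulr_ge0 ?exprn_ge0 //.
exact: hB.
Qed.

Lemma conv_moment_cvg c V p r n : 1 < c ->
  (forall n, p n = V n + p (n - 1) / c) ->
  (forall n, r n = p (n - 1) / c + r (n - 1) / c) ->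
  left_bounded p -> left_bounded r ->
  \sum_(0 <= j < N) j%:R * c^-1 ^+ j * V (n - j%:Z) @[N --> \oo] --> r n.
Proof.
move=> c1 hp hr /(_ n)[M hM] /(_ n)[L hL].
under eq_fun do rewrite (conv_moment_sum c1 hp hr).
apply: (@cvg_eq_lim _ (r n - 0 - 0)); first by rewrite !subr0.
apply: cvgB; first apply: cvgB.
- exact: cvg_cst.
- by apply: cvg0M_bounded (cvg_geometric0 c1) _ => N; apply: hL; rewrite gerBl.
- by apply: cvg0M_bounded (cvg_moment0 c1) _ => N; apply: hM; rewrite gerBl.
Qed.

End two_sided_sequences.

(** * The kernels of fractional integration and differentiation on spheres *)

Section fractional_kernel.
Variables (R : realType) (Q X : R).
Hypotheses (Q1 : 1 < Q) (X1 : 1 < X).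

(** With b Q^k the measure of the sphere of radius Q^k, [A] and [gamma] are b times the constants of
    I^alpha (alpha <> 1) and of D^alpha, and [kappa] is the sum of Q^-j and X^-j over j >= 0, the
    total weight of the value subtracted in D^alpha. *)
Local Notation b := (1 - Q^-1).
Local Notation A := ((1 - X^-1) * b / (1 - X / Q)).
Local Notation gamma := ((1 - X) / (1 - (Q * X)^-1) * b).
Local Notation kappa := (Q / (Q - 1) + X / (X - 1)).

Let Q0 : Q != 0. Proof. by rewrite gt_eqF // (lt_trans ltr01). Qed.
Let X0 : X != 0. Proof. by rewrite gt_eqF // (lt_trans ltr01). Qed.
Let Qm1 : Q - 1 != 0. Proof. by rewrite subr_eq0 gt_eqF. Qed.
Let Xm1 : X - 1 != 0. Proof. by rewrite subr_eq0 gt_eqF. Qed.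
Let Xm1' : 1 - X != 0. Proof. by rewrite subr_eq0 lt_eqF. Qed.
Let QX1 : Q * X - 1 != 0.
Proof. by rewrite subr_eq0 gt_eqF // mulr_egt1. Qed.

(* The kernel of I^alpha on spheres: the coefficient, for j > 0, of
   [V (n - j)] in the sequence [s] of [frac_data] below. *)
Definition frac_kernel (j : nat) : R :=
  if X == Q then - b ^+ 2 * (j%:R * Q^-1 ^+ j)
  else A * (Q^-1 ^+ j - X^-1 ^+ j).

(* With [V k] the value of v on the sphere of radius Q^k and X = Q^alpha,
   [X ^ n * s n] is (I^alpha v)(Q^n), while [P n] and [T n] are the sums of
   [(Q * X)^-j s (n - j)] and of [s (n + j)] over j >= 0, i.e. the two halves of
   D^alpha I^alpha v. *)
Definition frac_data (V s P T : int -> R) : Prop :=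
  [/\ dominated V s /\ dominated V P,
      right_summable V -> right_summable s /\ right_summable T,
      (forall n, T n = s n + T (n + 1)) /\
      (forall n, P n = s n + P (n - 1) / (Q * X)),
      forall n, V n = gamma * (P n + T n - kappa * s n) &
      forall n, \sum_(0 <= j < N) frac_kernel j * V (n - j%:Z) @[N --> \oo] -->
        s n - X^-1 * V n].

Lemma frac_kernel_summable :
  exists B, forall N, \sum_(0 <= j < N) `|frac_kernel j| <= B.
Proof.
have Qi : 0 <= Q^-1 by rewrite invr_ge0 ltW // (lt_trans ltr01).
have Xi : 0 <= X^-1 by rewrite invr_ge0 ltW // (lt_trans ltr01).
have Qi1 : Q^-1 < 1 by rewrite invf_lt1 // (lt_trans ltr01).
have Xi1 : X^-1 < 1 by rewrite invf_lt1 // (lt_trans ltr01).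
rewrite /frac_kernel; case: eqVneq => XQ.
  have [B hB] := moment_bounded Q1; exists (`|- b ^+ 2| * B) => N.
  apply: le_trans (ler_wpM2l (normr_ge0 (- b ^+ 2)) (hB N)).
  rewrite mulr_sumr.
  apply: ler_sum => j _; rewrite normrM ler_wpM2l //.
  by rewrite ger0_norm // mulr_ge0 // exprn_ge0.
exists (`|A| * ((1 - Q^-1)^-1 + (1 - X^-1)^-1)) => N.
apply: le_trans (ler_wpM2l (normr_ge0 A) (lerD (sum_geometric_le N Qi Qi1)
  (sum_geometric_le N Xi Xi1))).
rewrite -big_split mulr_sumr; apply: ler_sum => j _; rewrite normrM ler_wpM2l //.
apply: le_trans (ler_normB _ _) _.
by rewrite !ger0_norm // exprn_ge0.
Qed.

(** Here the kernel is a difference of two geometric sequences, so s is a combination of V and of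
    two convolutions. *)
Lemma frac_transform_ne (V : int -> R) : X != Q -> left_bounded V ->
  exists s P T : int -> R, frac_data V s P T.
Proof.
move=> XQ hV.
have QX : Q - X != 0 by rewrite subr_eq0 eq_sym.
have [p [hp dp]] := conv_exists Q1 hV.
have [r [hr dr]] := conv_exists X1 hV.
pose s n := X^-1 * V n + A * (p n + -1 * r n).
(* The tail of V in the sum of s over l >= n cancels, which leaves this closed form. *)
pose T n := (A / (Q - 1)) * p (n - 1) + - (A / (X - 1)) * r (n - 1).
(* P is defined by solving the inversion formula; what remains is its recurrence, a rational
   identity. *)
pose P n := gamma^-1 * V n + (kappa * s n + -1 * T n).
have dV := dominated_refl V.
have ds : dominated V s.
  by do !(apply: dominatedD || apply: dominatedZ).
have dT : dominated V T.
  by apply: dominatedD; apply: dominatedZ; apply: dominated_pred.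
exists s, P, T; split.
- split=> //; apply: dominatedD; first exact: dominatedZ.
  by apply: dominatedD; apply: dominatedZ.
- move=> rV; have rp := conv_right_summable Q1 hp rV.
  have rr := conv_right_summable X1 hr rV.
  split; first by do !(apply: right_summableD || apply: right_summableZ).
  by apply: right_summableD; apply: right_summableZ; apply: right_summable_pred.
- split=> n; rewrite /P /T /s ?addrK.
    rewrite (hp n) (hr n); field.
    by rewrite Q0 X0 Qm1 Xm1 QX.
  rewrite (hp n) (hr n) (hp (n - 1)) (hr (n - 1)); field.
  by rewrite Q0 X0 Qm1 Xm1 QX Xm1' QX1.
- move=> n; rewrite /P; field.
  by rewrite Q0 X0 Qm1 Xm1 Xm1' QX1.
move=> n; have lp := dominated_left hV dp; have lr := dominated_left hV dr.
apply: (@cvg_eq_lim _ _ (A * (p n - r n))).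
  by rewrite /s; ring.
have -> : (fun N => \sum_(0 <= j < N) frac_kernel j * V (n - j%:Z)) =
  (fun N => A * (\sum_(0 <= j < N) Q^-1 ^+ j * V (n - j%:Z) -
                 \sum_(0 <= j < N) X^-1 ^+ j * V (n - j%:Z))).
  apply/funext => N; rewrite -sumrB mulr_sumr; apply: eq_bigr => j _.
  by rewrite /frac_kernel (negbTE XQ); ring.
apply: cvgM; first exact: cvg_cst.
by apply: cvgB; apply: conv_cvg.
Qed.

(** At X = Q the two ratios coincide and A (Q^-j - X^-j) is replaced by its limit - b^2 j Q^-j, so
    the second convolution is applied to p. *)
Lemma frac_transform_eq (V : int -> R) : X = Q -> left_bounded V ->
  exists s P T : int -> R, frac_data V s P T.
Proof.
move=> XQ hV.
have [p [hp dp]] := conv_exists Q1 hV.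
have lp := dominated_left hV dp.
pose p' n := Q^-1 * p (n - 1).
have dp' : dominated p p'.
  by apply: dominatedZ; apply: dominated_pred; exact: dominated_refl.
have lp' := dominated_left lp dp'.
have [r [hr' dr']] := conv_exists Q1 lp'.
have dr : dominated V r by apply: dominated_trans dr' => //; apply: dominated_trans dp'.
have hr n : r n = p (n - 1) / Q + r (n - 1) / Q by rewrite hr' /p' mulrC.
pose s n := Q^-1 * V n + - b ^+ 2 * r n.
(* As for X <> Q, the values V l with l >= n cancel in the sum of s l over l >= n. *)
pose T n := - (Q * b ^+ 2 / (Q - 1) ^+ 2) * p (n - 1) + - (b ^+ 2 / (Q - 1)) * r (n - 1).
pose P n := gamma^-1 * V n + (kappa * s n + -1 * T n).
have dV := dominated_refl V.
have ds : dominated V s by apply: dominatedD; apply: dominatedZ.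
have dT : dominated V T.
  by apply: dominatedD; apply: dominatedZ; apply: dominated_pred.
exists s, P, T; split.
- split=> //; apply: dominatedD; first exact: dominatedZ.
  by apply: dominatedD; apply: dominatedZ.
- move=> rV; have rp := conv_right_summable Q1 hp rV.
  have rp' : right_summable p' by apply: right_summableZ; exact: right_summable_pred.
  have rr := conv_right_summable Q1 hr' rp'.
  split; first by apply: right_summableD; apply: right_summableZ.
  by apply: right_summableD; apply: right_summableZ; apply: right_summable_pred.
- have QX1' : Q * Q - 1 != 0 by rewrite -{2}XQ.
  have Qm1' : 1 - Q != 0 by rewrite -XQ.
  split=> n; rewrite /P /T /s ?XQ ?addrK.
    rewrite (hp n) (hr n); field.
    by rewrite Q0 Qm1.
  rewrite (hr n) (hp (n - 1)) (hr (n - 1)); field.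
  by rewrite Q0 Qm1 Qm1' QX1'.
- move=> n; rewrite /P; field.
  by rewrite Q0 X0 Qm1 Xm1 Xm1' QX1.
move=> n; have lr := dominated_left hV dr.
apply: (@cvg_eq_lim _ _ (- b ^+ 2 * r n)).
  by rewrite /s XQ; ring.
have -> : (fun N => \sum_(0 <= j < N) frac_kernel j * V (n - j%:Z)) =
  (fun N => - b ^+ 2 * \sum_(0 <= j < N) j%:R * Q^-1 ^+ j * V (n - j%:Z)).
  apply/funext => N; rewrite mulr_sumr; apply: eq_bigr => j _.
  by rewrite /frac_kernel XQ eqxx !mulrA.
apply: cvgM; first exact: cvg_cst.
exact: conv_moment_cvg.
Qed.

Lemma frac_transform (V : int -> R) : left_bounded V ->
  exists s P T : int -> R, frac_data V s P T.
Proof.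
have [XQ|XQ] := eqVneq X Q; first exact: frac_transform_eq.
exact: frac_transform_ne.
Qed.

End fractional_kernel.

(** * Summability at infinity from the decay of the coefficients *)

(** [E] stands for Q^eps. Once C E^-n (1 + G) < 1, a value |V n| above 1 cannot exceed all its
    predecessors, which bounds V; inserting this bound into the equation gives the rate E^-n. *)
Lemma decay_right_summable (R : realType) (X E C : R) (V a f s : int -> R) :
  0 < X -> 1 < E -> 0 < C ->
  (forall n, V n + a n * (X ^ n * s n) = f n) ->
  (forall n, 0 < n -> `|a n| * X ^ n <= C * E ^ (- n) /\ `|f n| <= C * E ^ (- n)) ->
  left_bounded V -> dominated V s -> right_summable V.
Proof.
move=> X0 E1 C0 hV haf lV [G0 dG0].
pose G := `|G0|.
have dG n M : (forall k, k <= n -> `|V k| <= M) -> `|s n| <= G * M.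
  move=> h; apply: le_trans (dG0 _ _ h) _; rewrite ler_wpM2r ?ler_norm //.
  exact: le_trans (h n _).
have E0 : 0 < E := lt_trans ltr01 E1.
have key n M : 0 < n -> (forall k, k <= n -> `|V k| <= M) ->
    `|V n| <= C * E ^ (- n) * (1 + G * M).
  move=> n0 hM; have -> : V n = f n - a n * (X ^ n * s n) by rewrite -hV addrK.
  have [h1 h2] := haf _ n0.
  apply: le_trans (ler_normB _ _) _; rewrite mulrDr mulr1 lerD //.
  rewrite !normrM (ger0_norm (exprz_ge0 _ (ltW X0))) mulrA.
  by apply: ler_pM => //; [rewrite mulr_ge0 // exprz_ge0 ?ltW | exact: dG].
have [m hm] : exists m : nat, (0 < m)%N /\
    forall n : int, m%:Z <= n -> C * E ^ (- n) * (1 + G) < 1.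
  have : (C * (1 + G)) * E^-1 ^+ N @[N --> \oo] --> 0.
    apply: (@cvg_eq_lim _ _ (C * (1 + G) * 0)); first by rewrite mulr0.
    by apply: cvgM; [exact: cvg_cst | exact: cvg_geometric0].
  move=> /cvgr_lt /(_ 1 ltr01)[m _ hm]; exists m.+1; split => // n hn.
  case: n hn => // n hn.
  rewrite mulrAC -exprz_inv; apply: hm => /=; lia.
case: hm => m0 hm.
have [M0 hM0] := lV m%:Z.
(* The 1 in the maximum allows 1 + G |V k| <= (1 + G) |V k| whenever |V k| exceeds M. *)
pose M := Num.max 1 M0.
have M1 : 1 <= M by rewrite le_max lexx.
have hM (j : nat) : forall k, k <= m%:Z + j%:Z -> `|V k| <= M.
  elim: j => [|j IH] k; first by rewrite addr0 => /hM0/le_trans; apply; rewrite le_max lexx orbT.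
  move=> hk; have [kle|] := boolP (k <= m%:Z + j%:Z); first exact: IH.
  rewrite -ltNge => klt; rewrite leNgt; apply/negP => MV.
  (* A value above M would be the largest so far, and [key] with this value as bound would make it
     smaller than itself. *)
  have kM l : l <= k -> `|V l| <= `|V k|.
    rewrite le_eqVlt => /orP[/eqP->//|lk]; apply: le_trans (IH _ _) (ltW MV).
    lia.
  have k0 : 0 < k by lia.
  have := key k _ k0 kM; rewrite leNgt => /negP; apply.
  apply: (@le_lt_trans _ _ (C * E ^ (- k) * (1 + G) * `|V k|)).
    have Ek : 0 <= C * E ^ (- k) by rewrite mulr_ge0 ?exprz_ge0 ?ltW.
    rewrite -[leRHS]mulrA ler_wpM2l // mulrDl mul1r lerD2r.
    exact: le_trans M1 (ltW MV).
  rewrite gtr_pMl ?hm //; first lia.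
  exact: lt_le_trans ltr01 (le_trans M1 (ltW MV)).
have hMall k : `|V k| <= M.
  by apply: (hM `|k|%N); lia.
have hdec n : 0 < n -> `|V n| <= C * (1 + G * M) * E ^ (- n).
  by move=> n0; rewrite mulrAC; apply: key.
(* For k > 0 the first summand gives the decay; for k <= 0, E^-k >= 1 and the bound M suffices. *)
pose D := C * (1 + G * M) + M.
have M0' : 0 <= M := le_trans ler01 M1.
have CGM : 0 <= C * (1 + G * M).
  by rewrite (mulr_ge0 (ltW C0)) // addr_ge0 // (mulr_ge0 (normr_ge0 G0)).
have hD k : `|V k| <= D * E ^ (- k).
  have Ek : 0 <= E ^ (- k) by rewrite exprz_ge0 // ltW.
  have [k0|k0] := ltP 0 k.
    by apply: le_trans (hdec _ k0) _; rewrite ler_wpM2r // lerDl.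
  apply: le_trans (hMall k) _; apply: (@le_trans _ _ (M * E ^ (- k))).
    have -> : - k = `|k|%:Z by lia.
    by rewrite ler_peMr // exprn_ege1 // ltW.
  by rewrite ler_wpM2r // lerDr.
have Ei : 0 <= E^-1 by rewrite invr_ge0 ltW.
move=> n; exists (D * E ^ (- n) * (1 - E^-1)^-1) => N.
apply: (@le_trans _ _ (D * E ^ (- n) * \sum_(0 <= j < N) E^-1 ^+ j)).
  rewrite mulr_sumr; apply: ler_sum => j _; apply: le_trans (hD _) _.
  by rewrite opprD expfzDr ?gt_eqF // mulrA -(exprz_inv E j%:Z).
rewrite ler_wpM2l //; first by rewrite mulr_ge0 ?addr_ge0 // exprz_ge0 // ltW.
by apply: sum_geometric_le => //; rewrite invf_lt1.
Qed.

(** * Fractional integration and differentiation of radial functions *)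

Section powers.
Variable R : realType.
Implicit Types (c r alpha : R) (k n : int) (j : nat).

Lemma powR_gt1 c alpha : 1 < c -> 0 < alpha -> 1 < c `^ alpha.
Proof.
by move=> c1 a0; rewrite /powR gt_eqF ?(lt_trans ltr01) // expR_gt1 mulr_gt0 ?ln_gt0.
Qed.

(** Matches the split alpha = 1 in [Ialpha] with the split X = Q in [frac_kernel]. *)
Lemma powR_eq_base c alpha : 1 < c -> (c `^ alpha == c) = (alpha == 1).
Proof.
move=> c1; apply/eqP/eqP => [|->]; last by rewrite powRr1 // ltW // (lt_trans ltr01).
move=> /(congr1 (@ln R)); rewrite ln_powR => h.
by apply: (@mulIf _ (ln c)); rewrite ?mul1r // gt_eqF // ln_gt0.
Qed.

Lemma powR_exprz c alpha k : 0 <= c -> (c ^ k) `^ alpha = (c `^ alpha) ^ k.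
Proof. by move=> c0; rewrite -(powR_intmul k c0) powRAC powR_intmul ?powR_ge0. Qed.

Lemma powR_sub1 r alpha : 0 < r -> r `^ (alpha - 1) = r `^ alpha / r.
Proof.
move=> r0; have -> : r `^ (alpha - 1) = r `^ alpha * r `^ (-1).
  by apply: powRD; rewrite (gt_eqF r0) implybT.
by rewrite powRN powRr1 // ltW.
Qed.

Lemma powR_Nsub1 r alpha : 0 < r -> r `^ (- alpha - 1) = (r * r `^ alpha)^-1.
Proof. by move=> r0; rewrite powR_sub1 // powRN invfM mulrC. Qed.

Lemma exprzDn c n j : c != 0 -> c ^ (n + j%:Z) = c ^ n * c ^+ j.
Proof. by move=> c0; rewrite expfzDr. Qed.

Lemma exprzBn c n j : c != 0 -> c ^ (n - j%:Z) = c ^ n * c^-1 ^+ j.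
Proof. by move=> c0; rewrite expfzDr // -exprz_inv. Qed.

End powers.

Section fractional_operators.
Context (R : realType) (K : fieldType) (q : nat) (absK : K -> R)
  (mu : {measure set (KBorel absK) -> \bar R}).
Hypothesis HK : local_field_data q mu.
Variable alpha : R.
Hypothesis alpha0 : 0 < alpha.

Local Notation Q := (q%:R : R).
Local Notation X := (Q `^ alpha).
Local Notation b := (1 - Q^-1).

Let Q1 : 1 < Q := q_gt1 HK.
Let X1 : 1 < X := powR_gt1 Q1 alpha0.
Let Q0 : 0 < Q := lt_trans ltr01 Q1.
Let X0 : 0 < X := lt_trans ltr01 X1.
Let Qn : Q != 0. Proof. by rewrite gt_eqF. Qed.
Let Xn : X != 0. Proof. by rewrite gt_eqF. Qed.
Let b0 : 0 < b. Proof. by rewrite subr_gt0 invf_lt1. Qed.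
Let Qi : 0 <= Q^-1. Proof. by rewrite invr_ge0 ltW. Qed.
Let Xi : 0 <= X^-1. Proof. by rewrite invr_ge0 ltW. Qed.
Let Qi1 : Q^-1 < 1. Proof. by rewrite invf_lt1. Qed.
Let Xi1 : X^-1 < 1. Proof. by rewrite invf_lt1. Qed.

Let powR_qz (k : int) : (Q ^ k) `^ alpha = X ^ k.
Proof. exact/powR_exprz/ltW. Qed.

Section fractional_integral.
Variables (v : R -> R) (s : int -> R).
Local Notation V := (fun k : int => v (Q ^ k)).
Hypothesis V_bounded : left_bounded V.
Hypothesis V_sum : forall n,
  \sum_(0 <= j < N) frac_kernel Q X j * V (n - j%:Z) @[N --> \oo] -->
    s n - X^-1 * V n.

(** Common to both forms of I^alpha: [k] is the constant before the integral, and the hypothesis on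
    F identifies the contribution of each sphere with a term of the kernel series. *)
Lemma kernel_integral (k : R) (F : KBorel absK -> R) (n : int) :
  k != 0 ->
  (forall j (y : KBorel absK), (0 < j)%N -> absK (y : K) = Q ^ (n - j%:Z) ->
     k * F y * (b * Q ^ (n - j%:Z)) = X ^ n * (frac_kernel Q X j * V (n - j%:Z))) ->
  k * \int[mu]_(y in [set y : KBorel absK | absK (y : K) < Q ^ n]) F y =
  X ^ n * (s n - X^-1 * V n).
Proof.
move=> k0 hF.
have bQ j : b * Q ^ (n - j%:Z) != 0 by rewrite mulf_neq0 ?gt_eqF // exprz_gt0.
pose e j := frac_kernel Q X j * V (n - j%:Z).
(* The value of F on the sphere of radius Q^(n-j), recovered by dividing by its measure; [w 0 = 0]
   since the kernel vanishes at j = 0. *)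
pose w j := (X ^ n / k) * e j / (b * Q ^ (n - j%:Z)).
have wE j : w j * (b * Q ^ (n - j%:Z)) = (X ^ n / k) * e j.
  by rewrite /w divfK.
have w0 : w 0%N = 0.
  by rewrite /w /e /frac_kernel !expr0 subrr mul0r !mulr0 if_same !mul0r mulr0 mul0r.
have [B hB] := frac_kernel_summable Q1 X1.
have [M hM] := V_bounded n.
have hw j (y : KBorel absK) : (0 < j)%N ->
    absK ((y : K) - 0) = Q ^ (n - j%:Z) -> F y = w j.
  move=> j0; rewrite subr0 => hy; apply: (mulIf (bQ j)); rewrite wE.
  by apply: (mulfI k0); rewrite mulrA hF // /e; field.
have wB N : \sum_(0 <= j < N) `|w j| * (b * Q ^ (n - j%:Z)) <= `|X ^ n / k| * (B * M).
  apply: (@le_trans _ _ (`|X ^ n / k| * \sum_(0 <= j < N) (`|frac_kernel Q X j| * M))).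
    rewrite mulr_sumr; apply: ler_sum => j _.
    have h : 0 <= b * Q ^ (n - j%:Z) by rewrite mulr_ge0 ?ltW // exprz_gt0.
    rewrite -{1}(ger0_norm h) -normrM wE normrM ler_wpM2l // normrM ler_wpM2l //.
    by apply: hM; rewrite gerBl.
  rewrite ler_wpM2l // -mulr_suml ler_wpM2r //.
  exact: le_trans (hM n _).
have wS : \sum_(0 <= j < N) w j * (b * Q ^ (n - j%:Z)) @[N --> \oo] -->
    X ^ n / k * (s n - X^-1 * V n).
  under eq_fun do under eq_bigr do rewrite wE.
  under eq_fun do rewrite -mulr_sumr.
  by apply: cvgMl_tmp; exact: V_sum.
have [_ _ hI] := integral_openball HK w0 hw wB wS.
have -> : [set y : KBorel absK | absK (y : K) < Q ^ n] =
    [set y : KBorel absK | absK ((y : K) - 0) < Q ^ n].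
  by apply/seteqP; split => y; rewrite /= subr0.
by rewrite hI; field; rewrite Xn k0.
Qed.

Lemma Ialpha_q (n : int) : Ialpha q mu alpha v (Q ^ n) = X ^ n * s n.
Proof.
have Qn0 : 0 < Q ^ n by rewrite exprz_gt0.
(* The local term of I^alpha accounts for X^n X^-1 V n, the integral for the rest. *)
rewrite /Ialpha gt_eqF // -[RHS](subrK (X ^ n * (X^-1 * V n))) -mulrBr.
rewrite [RHS]addrC; case: eqVneq => a1.
  have XQ : X = Q by apply/eqP; rewrite powR_eq_base // a1.
  have lnQ : ln Q != 0 by rewrite gt_eqF // ln_gt0.
  have Qm : 1 - Q != 0 by rewrite subr_eq0 lt_eqF.
  congr (_ + _); first by rewrite XQ mulrCA !mulrA.
  apply: kernel_integral.
    by rewrite mulf_neq0 // invr_eq0 mulf_neq0.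
  move=> j y j0 ->; rewrite /frac_kernel XQ eqxx.
  (* Hence ln Q^n - ln Q^(n-j) = j ln Q, which produces the weight j of the kernel. *)
  have lnz (k : int) : ln (Q ^ k) = k%:~R * ln Q.
    by rewrite -powR_intmul ?(ltW Q0) // ln_powR.
  rewrite !lnz exprzBn // rmorphB /=.
  have -> : (j%:Z)%:~R = j%:R :> R by [].
  by field; rewrite Qn lnQ.
congr (_ + _).
  by rewrite powRN powR_qz mulrCA !mulrA.
have XQ : X != Q by rewrite powR_eq_base.
have QX : Q - X != 0 by rewrite subr_eq0 eq_sym.
have h1 : 1 - X / Q != 0.
  have -> : 1 - X / Q = (Q - X) / Q by field.
  by rewrite mulf_neq0 // invr_eq0.
rewrite powRN powR_sub1 //; apply: kernel_integral.
  by rewrite mulf_neq0 ?invr_eq0 // subr_eq0 gt_eqF.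
move=> j y j0 ->; rewrite /frac_kernel (negbTE XQ).
rewrite !powR_sub1 ?exprz_gt0 // !powR_qz !exprzBn //.
have Qj : Q^-1 ^+ j != 0 by rewrite expf_neq0 // invr_eq0.
have Qnn : Q ^ n != 0 by rewrite gt_eqF.
by field; rewrite QX Qn Xn Qj Qnn.
Qed.

End fractional_integral.

Section fractional_derivative.
Variables (U : R -> R) (V s P T : int -> R).
Hypothesis UE : forall n, U (Q ^ n) = X ^ n * s n.
Hypotheses (s_bounded : left_bounded s) (P_bounded : left_bounded P).
Hypotheses (s_summable : right_summable s) (T_summable : right_summable T).
Hypothesis TE : forall n, T n = s n + T (n + 1).
Hypothesis PE : forall n, P n = s n + P (n - 1) / (Q * X).
Hypothesis VE : forall n, V n = (1 - X) / (1 - (Q * X)^-1) * b *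
  (P n + T n - (Q / (Q - 1) + X / (X - 1)) * s n).

Lemma absK_powR (y : K) (k : int) : absK y = Q ^ k ->
  absK y `^ (- alpha - 1) = (Q ^ k * X ^ k)^-1.
Proof. by move=> ->; rewrite powR_Nsub1 ?exprz_gt0 // powR_qz. Qed.

Variables (x : K) (n : int).
Hypothesis xn : absK x = Q ^ n.

Let F : KBorel absK -> R := Dalpha_integrand alpha U x.

(* By the ultrametric inequality the integrand at y depends only on |y - x|. *)
Lemma Dalpha_inner :
  let D := [set y : KBorel absK | absK ((y : K) - x) < Q ^ n] in
  [/\ measurable D, mu.-integrable D (EFin \o F) &
      \int[mu]_(y in D) F y = b * (P n - (1 - Q^-1)^-1 * s n)].
Proof.
(* Here |y| = |x| = Q^n while |x - y| = Q^(n-j), so the singular factor is constant. *)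
pose w (j : nat) := (Q ^ n * X ^ n)^-1 *
  (X ^ (n - j%:Z) * s (n - j%:Z) - X ^ n * s n).
have Xz k : X ^ k != 0 by rewrite gt_eqF // exprz_gt0.
have Qz k : Q ^ k != 0 by rewrite gt_eqF // exprz_gt0.
have wE j : w j * (b * Q ^ (n - j%:Z)) =
    b * ((Q * X)^-1 ^+ j * s (n - j%:Z) - Q^-1 ^+ j * s n).
  rewrite /w !exprzBn // [(Q * X)^-1]invfM exprMn.
  by field; rewrite Xz Qz Qn.
have QX1 : 1 < Q * X by rewrite mulr_egt1 // X1.
have QXi : 0 <= (Q * X)^-1 by rewrite invr_ge0 mulr_ge0 ?ltW.
have QXi1 : (Q * X)^-1 < 1 by rewrite invf_lt1 // mulr_gt0.
have [M hM] := s_bounded n.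
have M0 : 0 <= M by exact: le_trans (hM n _).
apply: (@integral_openball R K q absK mu HK x n F w
  (b * ((1 - (Q * X)^-1)^-1 * M + (1 - Q^-1)^-1 * M))).
- by rewrite /w subr0 subrr mulr0.
- move=> j y j0 hy; rewrite /F /Dalpha_integrand.
  have lt : absK ((y : K) - x) < absK x.
    by rewrite hy xn (ltr_eXz2l Q1) gtrBl.
  have yn : absK (y : K) = Q ^ n by rewrite -xn -(absKD_eq HK lt) subrK.
  by rewrite (absK_powR yn) (absKBC HK) hy xn !UE.
- move=> N.
  apply: (@le_trans _ _ (b * (\sum_(0 <= j < N) (Q * X)^-1 ^+ j * M +
                              \sum_(0 <= j < N) Q^-1 ^+ j * M))).
    rewrite -big_split mulr_sumr; apply: ler_sum => j _.
    have h : 0 <= b * Q ^ (n - j%:Z) by rewrite mulr_ge0 ?ltW // exprz_gt0.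
    rewrite -{1}(ger0_norm h) -normrM wE normrM (ger0_norm (ltW b0)).
    rewrite ler_wpM2l ?(ltW b0) //; apply: le_trans (ler_normB _ _) _.
    rewrite !normrM (ger0_norm (exprn_ge0 _ QXi)) (ger0_norm (exprn_ge0 _ Qi)).
    by rewrite lerD // ler_wpM2l ?exprn_ge0 // hM // gerBl.
  rewrite ler_wpM2l ?(ltW b0) // lerD // -mulr_suml ler_wpM2r //;
    exact: sum_geometric_le.
- under eq_fun do under eq_bigr do rewrite wE.
  under eq_fun do rewrite -mulr_sumr sumrB -mulr_suml.
  apply: cvgMl_tmp; apply: cvgB; first exact: conv_cvg.
  by apply: cvgM; [exact: cvg_sum_geometric | exact: cvg_cst].
Qed.

(** Where |y - x| > |x|, one has |y| = |y - x|. On the sphere |y - x| = |x|, which contains the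
    singularity y = 0, |y| varies but the increment of U vanishes. *)
Lemma Dalpha_outer :
  let D := [set y : KBorel absK | Q ^ n <= absK ((y : K) - x)] in
  [/\ measurable D, mu.-integrable D (EFin \o F) &
      \int[mu]_(y in D) F y = b * (T n - (1 - X^-1)^-1 * s n)].
Proof.
pose w (j : nat) := (Q ^ (n + j%:Z) * X ^ (n + j%:Z))^-1 *
  (X ^ (n + j%:Z) * s (n + j%:Z) - X ^ n * s n).
have Xz k : X ^ k != 0 by rewrite gt_eqF // exprz_gt0.
have Qz k : Q ^ k != 0 by rewrite gt_eqF // exprz_gt0.
have wE j : w j * (b * Q ^ (n + j%:Z)) = b * (s (n + j%:Z) - X^-1 ^+ j * s n).
  rewrite /w !exprzDn // exprVn.
  by field; rewrite Xz Qz Qn !expf_neq0.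
have [B hB] := s_summable n.
apply: (@integral_ballC R K q absK mu HK x n F w
  (b * (B + (1 - X^-1)^-1 * `|s n|))).
- move=> j y hy; rewrite /F /Dalpha_integrand (absKBC HK) hy xn.
  case: j hy => [|j] hy; first by rewrite /w addr0 !subrr !mulr0.
  have lt : absK x < absK ((y : K) - x).
    by rewrite hy xn (ltr_eXz2l Q1) ltrDl.
  have yn : absK (y : K) = Q ^ (n + j.+1%:Z).
    by rewrite -hy -(absKD_eq HK lt) addrC subrK.
  by rewrite (absK_powR yn) !UE.
- move=> N.
  apply: (@le_trans _ _ (b * (\sum_(0 <= j < N) `|s (n + j%:Z)| +
                              \sum_(0 <= j < N) X^-1 ^+ j * `|s n|))).
    rewrite -big_split mulr_sumr; apply: ler_sum => j _.
    have h : 0 <= b * Q ^ (n + j%:Z) by rewrite mulr_ge0 ?ltW // exprz_gt0.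
    rewrite -{1}(ger0_norm h) -normrM wE normrM (ger0_norm (ltW b0)).
    rewrite ler_wpM2l ?(ltW b0) //; apply: le_trans (ler_normB _ _) _.
    by rewrite normrM (ger0_norm (exprn_ge0 _ Xi)).
  rewrite ler_wpM2l ?(ltW b0) // lerD // -mulr_suml ler_wpM2r //.
  exact: sum_geometric_le.
- under eq_fun do under eq_bigr do rewrite wE.
  under eq_fun do rewrite -mulr_sumr sumrB -mulr_suml.
  apply: cvgMl_tmp; apply: cvgB.
    (* T is the tail sum of s: it satisfies the recurrence and, being summable, tends to 0. *)
    by apply: telescope_cvg => //; exact: right_summable_cvg0.
  by apply: cvgM; [exact: cvg_sum_geometric | exact: cvg_cst].
Qed.

(** The two halves add up to b (P n + T n - kappa s n), which [VE] converts into V n. *)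
Lemma Dalpha_q :
  mu.-integrable setT (fun y => (F y)%:E) /\ Dalpha q mu alpha U x = V n.
Proof.
have [mI iI eI] := Dalpha_inner; have [mO iO eO] := Dalpha_outer.
set I := [set y | _] in mI iI eI; set O := [set y | _] in mO iO eO.
have IO : [set: KBorel absK] = I `|` O.
  by apply/seteqP; split => y // _; have [h|h] := ltP (absK ((y : K) - x)) (Q ^ n);
    [left|right].
have dIO : [disjoint I & O].
  apply/eqP/seteqP; split => y // [hI hO].
  by have := lt_le_trans hI hO; rewrite ltxx.
have iT : mu.-integrable setT (EFin \o F).
  by rewrite IO; exact: integrable_disjointU.
split=> //.
rewrite /Dalpha IO Rintegral_setU // -?IO // eI eO VE powR_Nsub1 // -mulrDr mulrA.
have Qm : Q - 1 != 0 by rewrite subr_eq0 gt_eqF.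
have Xm : X - 1 != 0 by rewrite subr_eq0 gt_eqF // X1.
have QXm : Q * X - 1 != 0 by rewrite subr_eq0 gt_eqF // mulr_egt1 // X1.
by field; rewrite Qn Xn Qm Xm QXm.
Qed.

End fractional_derivative.
End fractional_operators.

(** * From sequences back to radial functions: the strong solution *)

Lemma left_boundedP (R : realType) (V : int -> R) (m : int) (M : R) :
  (forall k, k <= m -> `|V k| <= M) -> left_bounded V.
Proof.
move=> hM n.
suff [M' h] : exists M', forall k, k <= m + `|n - m|%:Z -> `|V k| <= M'.
  by exists M' => k kn; apply: h; lia.
elim: `|n - m|%N => [|j [M' IH]]; first by exists M => k; rewrite addr0; exact: hM.
exists (Num.max M' `|V (m + j.+1%:Z)|) => k hk; rewrite le_max.
have [kj|kj] := leP k (m + j%:Z); first by rewrite IH.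
have -> : k = m + j.+1%:Z by lia.
by rewrite lexx orbT.
Qed.

Lemma eseries_bounded_lty (R : realType) (u : nat -> R) (B : R) :
  (forall j, 0 <= u j) -> (forall N, \sum_(0 <= j < N) u j <= B) ->
  (\sum_(0 <= j <oo) (u j)%:E < +oo)%E.
Proof.
move=> u0 uB; apply: (@le_lt_trans _ _ B%:E); last exact: ltry.
apply: lime_le; first by apply: is_cvg_nneseries => j _ _; rewrite lee_fin.
by apply: nearW => N; rewrite sumEFin lee_fin.
Qed.

Lemma exprzN_lt (R : realType) (c e : R) : 1 < c -> 0 < e ->
  exists m : nat, c ^ (- m%:Z) < e.
Proof.
move=> c1 e0; have /cvgr_lt/(_ e e0)[m _ hm] := cvg_geometric0 c1.
by exists m; rewrite -exprz_inv; apply: hm => /=.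
Qed.

Theorem theorem2 (R : realType) (K : fieldType) (q : nat) (absK : K -> R)
    (mu : {measure set (KBorel absK) -> \bar R})
    (HK : local_field_data q mu)
    (alpha : R) (halpha : 0 < alpha)
    (a f v : R -> R)
    (ha_cont : radial_continuous absK a) (hf_cont : radial_continuous absK f)
    (ha_ne : forall (x : K) (m : int), a (absK x) <> - (q%:R `^ (alpha * m%:~R)))
    (hv_cont : radial_continuous absK v)
    (hv_eq : forall x : K,
        v (absK x) + a (absK x) * Ialpha q mu alpha v (absK x) = f (absK x))
    (hdecay : exists eps : R, exists C : R, 0 < eps /\ 0 < C /\
        forall x : K, 1 < absK x ->
          `|a (absK x)| <= C * (absK x) `^ (- alpha - eps) /\
          `|f (absK x)| <= C * (absK x) `^ (- eps)) :
  strong_solution q mu alpha (Ialpha q mu alpha v) a f.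
Proof.
pose Q : R := q%:R; pose X : R := Q `^ alpha.
have Q1 : 1 < Q := q_gt1 HK.
have X1 : 1 < X := powR_gt1 Q1 halpha.
have Q0 : 0 < Q := lt_trans ltr01 Q1.
have X0 : 0 < X := lt_trans ltr01 X1.
pose V k := v (Q ^ k).
have lV : left_bounded V.
  (* Continuity at 0 bounds |v| by |v 0| + 1 on a small ball; only finitely many radii lie between
     it and any larger one. *)
  have [d d0 hd] := hv_cont 0 1 ltr01.
  have [m hm] := exprzN_lt Q1 d0.
  apply: (@left_boundedP _ _ (- m%:Z) (`|v 0| + 1)) => k hk.
  have [x xk] := absK_exists HK k.
  rewrite -lerBlDl; apply: le_trans (lerB_dist _ _) _; apply: ltW.
  have := hd x; rewrite subr0 xk (absK0 HK); apply.
  by apply: le_lt_trans hm; rewrite ler_eXz2l.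
have [s [P [T [[ds dP] sumV [TE PE] VE Vs]]]] := frac_transform Q1 X1 lV.
have ls := dominated_left lV ds; have lP := dominated_left lV dP.
pose U := Ialpha q mu alpha v.
have UE n : U (Q ^ n) = X ^ n * s n by exact: (Ialpha_q HK halpha lV Vs).
have U0 : U 0 = 0 by rewrite /U /Ialpha eqxx.
have rV : right_summable V.
  have [eps [C [e0 [C0 haf]]]] := hdecay.
  have E1 : 1 < Q `^ eps := powR_gt1 Q1 e0.
  apply: (@decay_right_summable _ X (Q `^ eps) C V (fun n => a (Q ^ n))
    (fun n => f (Q ^ n)) s) => //.
    by move=> n; have [x xn] := absK_exists HK n; rewrite -UE /V -xn.
  move=> n n0; have [x xn] := absK_exists HK n.
  have Qn1 : 1 < Q ^ n by rewrite -(expr0z Q) ltr_eXz2l.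
  have Qn0 : 0 < Q ^ n := lt_trans ltr01 Qn1.
  have := haf x; rewrite xn => /(_ Qn1)[h1 h2].
  have hE : (Q ^ n) `^ (- eps) = (Q `^ eps) ^ (- n).
    by rewrite powRN powR_exprz ?invr_expz // ltW.
  split; last by rewrite -hE.
  (* The factor X^n of I^alpha compensates r^-alpha in the bound on a, with r = Q^n. *)
  have -> : C * Q `^ eps ^ (- n) = C * (Q ^ n) `^ (- alpha - eps) * X ^ n.
    have -> : (Q ^ n) `^ (- alpha - eps) = (Q ^ n) `^ (- alpha) * (Q ^ n) `^ (- eps).
      by apply: powRD; rewrite (gt_eqF Qn0) implybT.
    rewrite -hE (powRN _ alpha) (powR_exprz alpha _ (ltW Q0)) -/X; field.
    by rewrite gt_eqF // exprz_gt0.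
  by rewrite ler_wpM2r // exprz_ge0 // ltW.
have [rs rT] := sumV rV.
have DU x n (xn : absK x = Q ^ n) :=
  Dalpha_q HK halpha UE ls lP rs rT TE PE VE xn.
have DUv x : x != 0 -> Dalpha q mu alpha U x = v (absK x).
  by move=> /(absK_val HK)[n xn]; rewrite (DU _ _ xn).2 xn.
rewrite -/U; split.
  (* Off 0 the absolute value is locally constant, so continuity is automatic there. *)
  move=> x0 e e0; have [->|x0n] := eqVneq x0 0; last first.
    exists (absK x0); first exact: absK_gt0 HK _ x0n.
    move=> x hx; have -> : absK x = absK x0.
      by rewrite -(absKD_eq HK hx) subrK.
    by rewrite subrr normr0.
  (* At 0, U(Q^n) = X^n s n is small because s is bounded to the left; adding 1 makes the bound
     positive. *)
  have [M hM] := ls 0; pose M' := M + 1.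
  have M'0 : 0 < M' by rewrite ltr_wpDl // (le_trans _ (hM 0 _)).
  have [m hm] := exprzN_lt X1 (divr_gt0 e0 M'0).
  exists (Q ^ (- m%:Z)); first by rewrite exprz_gt0.
  move=> x; rewrite subr0 (absK0 HK) U0 subr0.
  have [->|/(absK_val HK)[n ->]] := eqVneq x 0.
    by rewrite (absK0 HK) U0 normr0.
  rewrite ltr_eXz2l // => nm; rewrite UE normrM (ger0_norm (exprz_ge0 _ (ltW X0))).
  apply: (@le_lt_trans _ _ (X ^ (- m%:Z) * M')); last by rewrite -ltr_pdivlMr.
  apply: ler_pM => //; first by rewrite exprz_ge0 // ltW.
    by rewrite ler_eXz2l // ltW.
  by apply: (@le_trans _ _ M); [apply: hM; lia | rewrite lerDl].
(* Off 0, D^alpha u = v, so by continuity of v the value at 0 is v 0. *)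
exists (v 0); split; last first.
  split; first by move=> x x0; rewrite DUv // hv_eq.
  split=> //.
  by have := hv_eq 0; rewrite (absK0 HK).
split; last split.
(* With m = 0, the sum toward 0 is at most M times a geometric series, since X^-j <= 1; the sum at
   infinity is that of |s j|. *)
- exists 0; split.
    have [M hM] := ls 0.
    apply: (@eseries_bounded_lty _ _ ((1 - Q^-1)^-1 * M)) => [j|N].
      by rewrite mulr_ge0 // qpowE exprz_ge0 // ltW.
    apply: (@le_trans _ _ (\sum_(0 <= j < N) Q^-1 ^+ j * M)).
      apply: ler_sum => j _; rewrite !qpowE sub0r UE normrM.
      rewrite (ger0_norm (exprz_ge0 _ (ltW X0))) -!exprz_inv.
      rewrite ler_wpM2l ?exprn_ge0 ?invr_ge0 ?(ltW Q0) //.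
      apply: le_trans (hM (- j%:Z) _); last lia.
      by rewrite ler_piMl // exprn_ile1 ?invr_ge0 ?(ltW X0) // invf_le1 // ltW.
    rewrite -mulr_suml ler_wpM2r ?(le_trans _ (hM 0 _)) //.
    by apply: sum_geometric_le; rewrite ?invr_ge0 ?(ltW Q0) // invf_lt1.
  have [B hB] := rs 0.
  apply: (@eseries_bounded_lty _ _ B) => [j|N]; first by rewrite mulr_ge0 // powR_ge0.
  apply: le_trans (hB N); apply: ler_sum => j _.
  rewrite qpowE UE powRN (powR_exprz _ _ (ltW Q0)) normrM.
  rewrite (ger0_norm (exprz_ge0 _ (ltW X0))) mulKf // gt_eqF // exprz_gt0 //.
- by move=> x /(absK_val HK)[n xn]; exact: (DU _ _ xn).1.
move=> e e0; have [d d0 hd] := hv_cont 0 e e0; exists d => // x x0 xd.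
by have := hd x; rewrite subr0 (absK0 HK) DUv //; apply.
Qed.
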